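(* For every integer $r\ge 2$, the set $EP(r)$ of all eventually periodic maps is dense in $\mathrm{ITM}(r)$.
   Context: Let $I=[0,1)$ and $r\ge 2$. An interval translation mapping (ITM) on $r$ intervals is a map $T:I\to I$ given by parameters $0=\beta_0<\beta_1<\dots<\beta_{r-1}<\beta_r=1$ and $\gamma_1,\dots,\gamma_r\in\mathbb R$ with $\gamma_i\in[-\beta_{i-1},1-\beta_i]$, via $T(x)=x+\gamma_i$ for $x\in I_i=[\beta_{i-1},\beta_i)$, $1\le i\le r$. $\mathrm{ITM}(r)$ is the set of all such parameter vectors $(\gamma_1,\dots,\gamma_r,\beta_1,\dots,\beta_{r-1})$ with the subspace topology from $\mathbb R^{2r-1}$; a map is identified with its parameter vector. A map $T\in\mathrm{ITM}(r)$ is eventually periodic if every point of $I$ lands on a periodic point of $T$ under iteration. *)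

(* Defs.v *)
From mathcomp Require Import all_boot all_order all_algebra.
From mathcomp Require Import all_classical all_reals all_analysis.

Set Implicit Arguments.
Unset Strict Implicit.
Unset Printing Implicit Defensive.

Import Order.TTheory GRing.Theory Num.Theory.
Import numFieldNormedType.Exports.

Local Open Scope classical_set_scope.
Local Open Scope ring_scope.

(* Parameter vectors (gamma_1, ..., gamma_r, beta_1, ..., beta_(r-1)) live in
   R^(r + (r - 1)).  Intervals and translations are numbered from 0, so that
   gamma p i is the translation on [beta p i, beta p i.+1[ for i : 'I_r. *)

Definition gamma (R : realType) (r : nat) (p : 'rV[R]_(r + r.-1)) (i : 'I_r) : R :=
  p ord0 (lshift r.-1 i).

(* The default value 1 of nth supplies the right endpoint beta_r = 1. *)
Definition beta (R : realType) (r : nat) (p : 'rV[R]_(r + r.-1)) (k : nat) : R :=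
  nth 1 (0 :: [seq p ord0 (rshift r j) | j <- enum 'I_r.-1]) k.

Definition ITM (R : realType) (r : nat) : set 'rV[R]_(r + r.-1) :=
  [set p | forall i : 'I_r,
    beta p i < beta p i.+1 /\ - beta p i <= gamma p i <= 1 - beta p i.+1].
Arguments ITM : clear implicits.

(* For p in ITM r the intervals partition [0, 1[, so the index picked is the
   only possible one; outside [0, 1[ the value is irrelevant. *)
Definition itm (R : realType) (r : nat) (p : 'rV[R]_(r + r.-1)) (x : R) : R :=
  if [pick i : 'I_r | x \in `[beta p i, beta p i.+1[ ] is Some i
  then x + gamma p i else x.

Lemma itm_stable (R : realType) (r : nat) (p : 'rV[R]_(r + r.-1)) :
  ITM R r p -> forall x, x \in `[0, 1[ -> itm p x \in `[0, 1[.
Proof.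
move=> Hp x xI; rewrite /itm; case: pickP => [i|_ //].
have [_ /andP[g1 g2]] := Hp i.
rewrite !in_itv /= => /andP[b1 b2]; apply/andP; split.
  by rewrite -(subrr (beta p i)); exact: lerD.
by rewrite -(subrK (beta p i.+1) 1) addrC; exact: ler_ltD.
Qed.

Definition periodic_point (R : realType) (T : R -> R) (x : R) : Prop :=
  exists2 n : nat, (0 < n)%N & iter n T x = x.

Definition eventually_periodic (R : realType) (T : R -> R) : Prop :=
  forall x : R, x \in `[0, 1[ -> exists m : nat, periodic_point T (iter m T x).

(* ITM R r, as a type, carries the topology induced by R^(2r - 1). *)
Definition EP (R : realType) (r : nat) : set (ITM R r) :=
  [set p | eventually_periodic (itm (set_val p))].
Arguments EP : clear implicits.

(* Main.v *)
Require Import Defs.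
From mathcomp Require Import all_boot all_order all_algebra.
From mathcomp Require Import all_classical all_reals all_analysis.
Import numFieldNormedType.Exports.
From mathcomp Require Import lra.

(** If every translation length is rational, with common denominator N, then
    an orbit stays in the coset x + (1/N)Z, which meets [0, 1[ in finitely many
    points; so every orbit is eventually periodic
    ([eventually_periodic_of_steps]).  It therefore suffices to move the
    translations slightly to rational values while keeping the break points.
    The translation on the i-th interval is only constrained to a segment of
    length one minus the length of that interval; with at least two intervals
    this segment is nondegenerate ([itm_interval_lt1]), so rationals are dense
    in it. *)

Set Implicit Arguments.
Unset Strict Implicit.
Unset Printing Implicit Defensive.

Import Order.TTheory GRing.Theory Num.Theory.

Local Open Scope classical_set_scope.
Local Open Scope ring_scope.

Lemma common_denominator (F : archiRealFieldType) (I : finType) (q : I -> rat) :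
  exists2 N : nat, (0 < N)%N & forall i, N%:R * ratr (q i) \is a @Num.int F.
Proof.
exists (\prod_i `|denq (q i)|)%N.
  by apply: prodn_gt0 => i; rewrite absz_gt0 denq_neq0.
move=> i; rewrite (bigD1 i) //= mulnC natrM -mulrA rpredM ?rpred_nat //.
have -> : (`|denq (q i)|%:R : F) * ratr (q i) = (numq (q i))%:~R.
  rewrite natr_absz gtr0_norm ?denq_gt0 // /ratr mulrCA divff ?mulr1 //.
  by rewrite intr_eq0 denq_neq0.
exact: intr_int.
Qed.

(** Pigeonhole: the integers N (T^n x - x) all lie strictly between -N and N,
    so two iterates of x coincide, and the earlier one is periodic. *)
Lemma eventually_periodic_of_steps (R : realType) (T : R -> R) (N : nat) :
  (0 < N)%N ->
  (forall x, x \in `[0, 1[ -> T x \in `[0, 1[) ->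
  (forall x, x \in `[0, 1[ -> N%:R * (T x - x) \is a Num.int) ->
  eventually_periodic T.
Proof.
move=> N0 Tstable Tstep x xI.
have iterI n : iter n T x \in `[0, 1[ by elim: n => //= n; exact: Tstable.
have iter_step n : N%:R * (iter n T x - x) \is a Num.int.
  elim: n => [|n IHn] /=; first by rewrite subrr mulr0 rpred0.
  by rewrite -(subrKA (iter n T x)) mulrDr rpredD // Tstep.
have N0R : (0 : R) < N%:R by rewrite ltr0n.
(* Adding N makes these integers natural numbers below 2N, to be counted. *)
pose v n : R := N%:R * (iter n T x - x) + N%:R.
have v_bnd n : 0 <= v n < (N + N)%:R.
  have := iterI n; move: xI; rewrite !in_itv /= => /andP[x0 x1] /andP[y0 y1].
  rewrite /v natrD; move: (iter n T x) y0 y1 => y y0 y1; nra.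
have truncnKv n : (Num.truncn (v n))%:R = v n.
  apply: truncnK; rewrite natrEint (andP (v_bnd n)).1 andbT.
  by rewrite rpredD ?rpred_nat.
have trunc_lt n : (Num.truncn (v n) < N + N)%N.
  by rewrite -(ltr_nat R) truncnKv (andP (v_bnd n)).2.
pose f (n : 'I_(N + N).+1) : 'I_(N + N) := Ordinal (trunc_lt n).
have /injectivePn[i [j ij fij]] : ~~ injectiveb f.
  by apply/negP => /injectiveP /leq_card; rewrite !card_ord ltnn.
have Tij : iter i T x = iter j T x.
  have truncij : Num.truncn (v i) = Num.truncn (v j) := congr1 val fij.
  have /addIr : v i = v j by rewrite -(truncnKv i) -(truncnKv j) truncij.
  by move=> /(mulfI (lt0r_neq0 N0R)) /addIr.
have periodic_of_lt (m n : nat) :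
    (m < n)%N -> iter m T x = iter n T x -> periodic_point T (iter m T x).
  move=> mn Tmn; exists (n - m)%N; first by rewrite subn_gt0.
  by rewrite -iterD subnK 1?ltnW.
case: (ltngtP i j) => [lij|lji|/val_inj eij].
- by exists i; apply: periodic_of_lt lij Tij.
- by exists j; apply: periodic_of_lt lji (esym Tij).
- by rewrite eij eqxx in ij.
Qed.

Lemma beta_last (R : realType) (r : nat) (p : 'rV[R]_(r + r.-1)) :
  (0 < r)%N -> beta p r = 1.
Proof.
by case: r p => // r p _; rewrite /beta nth_default //= size_map size_enum_ord.
Qed.

Lemma beta_lt (R : realType) (r : nat) (p : 'rV[R]_(r + r.-1)) (m n : nat) :
  ITM R r p -> (m < n <= r)%N -> beta p m < beta p n.
Proof.
move=> Hp; elim: n => // n IHn /andP[mn nr].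
have [step _] := Hp (Ordinal nr).
move: mn; rewrite ltnS leq_eqVlt => /orP[/eqP -> //|mn].
by apply: lt_trans step; rewrite IHn // mn ltnW.
Qed.

(** A second interval takes up a positive part of [0, 1[, on the left of
    interval i or on its right. *)
Lemma itm_interval_lt1 (R : realType) (r : nat) (p : 'rV[R]_(r + r.-1)) (i : 'I_r) :
  (1 < r)%N -> ITM R r p -> beta p i.+1 - beta p i < 1.
Proof.
move=> r1 Hp; have b0 : beta p 0 = 0 by [].
have br : beta p r = 1 by rewrite beta_last // ltnW.
have [i0|i0] := posnP i.
  by rewrite i0 b0 subr0 -br beta_lt //= r1 leqnn.
have li : 0 < beta p i by rewrite -b0 beta_lt // i0 ltnW.
have : beta p i.+1 <= 1.
  have := ltn_ord i; rewrite leq_eqVlt => /orP[/eqP ->|ir]; first by rewrite br.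
  by rewrite -br ltW // beta_lt // ir leqnn.
by move=> ?; lra.
Qed.

Definition with_gamma (R : realType) (r : nat) (p : 'rV[R]_(r + r.-1))
    (g : 'I_r -> R) : 'rV[R]_(r + r.-1) :=
  row_mx (\row_i g i) (rsubmx p).

Lemma gamma_with_gamma (R : realType) (r : nat) (p : 'rV[R]_(r + r.-1)) g i :
  gamma (with_gamma p g) i = g i.
Proof. by rewrite /gamma row_mxEl mxE. Qed.

Lemma beta_with_gamma (R : realType) (r : nat) (p : 'rV[R]_(r + r.-1)) g k :
  beta (with_gamma p g) k = beta p k.
Proof.
rewrite /beta; congr (nth _ (_ :: _) _); apply: eq_map => j.
by rewrite row_mxEr mxE.
Qed.

Lemma ITM_with_gamma (R : realType) (r : nat) (p : 'rV[R]_(r + r.-1))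
    (g : 'I_r -> R) :
  ITM R r p -> (forall i : 'I_r, - beta p i <= g i <= 1 - beta p i.+1) ->
  ITM R r (with_gamma p g).
Proof.
move=> Hp Hg i; rewrite !beta_with_gamma gamma_with_gamma; split=> //.
by have [] := Hp i.
Qed.

Lemma ball_with_gamma (R : realType) (r : nat) (p : 'rV[R]_(r + r.-1))
    (g : 'I_r -> R) (e : R) :
  0 < e -> (forall i, `|gamma p i - g i| < e) -> ball p e (with_gamma p g).
Proof.
move=> e0 Hg; split=> // k j; rewrite (ord1 k) -ball_normE /=.
rewrite -(splitK j); case: (fintype.split j) => i /=.
  by rewrite row_mxEl mxE; exact: Hg.
by rewrite row_mxEr mxE subrr normr0.
Qed.

Lemma eventually_periodic_rational (R : realType) (r : nat)
    (p : 'rV[R]_(r + r.-1)) (q : 'I_r -> rat) :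
  ITM R r p -> (forall i, gamma p i = ratr (q i)) ->
  eventually_periodic (itm p).
Proof.
move=> Hp pq; have [N N0 NqZ] := common_denominator R q.
apply: (eventually_periodic_of_steps N0); first exact: itm_stable.
move=> x _; rewrite /itm; case: pickP => [i _|_].
  by rewrite addrAC subrr add0r pq.
by rewrite subrr mulr0 rpred0.
Qed.

Lemma rat_in_segment_near (R : realType) (a b c e : R) :
  a < b -> a <= c <= b -> 0 < e ->
  exists q : rat, a <= ratr q <= b /\ `|c - ratr q| < e.
Proof.
move=> ab /andP[ac cb] e0.
have lt : Num.max a (c - e) < Num.min b (c + e).
  by rewrite gt_max !lt_min; apply/andP; split; apply/andP; split; lra.
have [q] := rat_in_itvoo lt.
rewrite in_itv /= gt_max lt_min => /andP[/andP[aq ceq] /andP[qb qce]].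
exists q; rewrite !ltW //; split=> //.
by rewrite ltr_norml; apply/andP; split; lra.
Qed.

Theorem theoremA (R : realType) (r : nat) (hr : (2 <= r)%N) : dense (EP R r).
Proof.
move=> O [p Op] [A oA AO].
have Hp : ITM R r (set_val p) := set_valP p.
have Ap : A (set_val p) by move: Op; rewrite -AO.
have /nbhs_ballP[e /= e0 eA] := open_nbhs_nbhs (conj oA Ap).
have near_rat (i : 'I_r) : exists q : rat,
    - beta (set_val p) i <= ratr q <= 1 - beta (set_val p) i.+1 /\
    `|gamma (set_val p) i - ratr q| < e.
  apply: rat_in_segment_near => //; last by have [] := Hp i.
  by have := itm_interval_lt1 i hr Hp => ?; lra.
have [q Hq] := choice near_rat.
pose p' := with_gamma (set_val p) (fun i => ratr (q i)).
have Hp' : ITM R r p' by apply: (ITM_with_gamma Hp) => i; have [] := Hq i.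
have p'A : A p' by apply/eA/(ball_with_gamma e0) => i; have [] := Hq i.
exists (SigSub (mem_set Hp')); split; first by rewrite -AO.
rewrite /EP /=; apply: (eventually_periodic_rational Hp') => i.
exact: gamma_with_gamma.
Qed.
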